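(* Let $P_1,P_2,\dots,P_n$ be compatible Borel probability measures on $\mathbb{R}$. (i) If the $P_i$ are Bernoulli with parameters $p_i$ respectively, then $\&(P_1,\dots,P_n)$ is Bernoulli with parameter $p=\dfrac{\prod_{i=1}^n p_i}{\prod_{i=1}^n p_i+\prod_{i=1}^n(1-p_i)}$. (ii) If the $P_i$ are geometric with parameters $p_i$ respectively, then $\&(P_1,\dots,P_n)$ is geometric with parameter $p=1-\prod_{i=1}^n(1-p_i)$. (iii) If the $P_i$ are discrete uniform on $\{1,\dots,n_i\}$ respectively, then $\&(P_1,\dots,P_n)$ is discrete uniform on $\{1,\dots,\min_i n_i\}$. (iv) If the $P_i$ are Zipf with parameters $\alpha_i$ and $n_i$ respectively, then $\&(P_1,\dots,P_n)$ is Zipf with parameters $\alpha=\sum_{i=1}^n\alpha_i$ and $m=\min_i n_i$. (v) If the $P_i$ are Zeta with parameters $\alpha_i$ respectively, then $\&(P_1,\dots,P_n)$ is Zeta with parameter $\alpha=\sum_{i=1}^n\alpha_i$. (vi) If the $P_i$ are gamma with parameters $\alpha_i,\beta_i$ respectively, then $\&(P_1,\dots,P_n)$ is gamma with parameters $\alpha=\sum_{i=1}^n\alpha_i-(n-1)$ and $\beta=\left(\sum_{i=1}^n\beta_i^{-1}\right)^{-1}$. (vii) If the $P_i$ are beta with parameters $\alpha_i,\beta_i$ respectively, then $\&(P_1,\dots,P_n)$ is beta with parameters $\alpha=\sum_{i=1}^n\alpha_i-(n-1)$ and $\beta=\sum_{i=1}^n\beta_i-(n-1)$. (viii) If the $P_i$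 are continuous uniform on intervals $(a_i,b_i)$ respectively, then $\&(P_1,\dots,P_n)$ is uniform on $(\max_i a_i,\min_i b_i)$. (ix) If the $P_i$ are LaPlace with parameters $\alpha_i$ respectively, then $\&(P_1,\dots,P_n)$ is LaPlace with parameter $\alpha=\left(\sum_{i=1}^n\alpha_i^{-1}\right)^{-1}$. (x) If the $P_i$ are Pareto with parameters $\alpha_i,\beta_i$ respectively, then $\&(P_1,\dots,P_n)$ is Pareto with parameters $\alpha=\sum_{i=1}^n\alpha_i+n-1$ and $\beta=\max_i\beta_i$. (xi) If the $P_i$ are exponential with means $\alpha_i$ respectively, then $\&(P_1,\dots,P_n)$ is exponential with mean $\alpha=\left(\sum_{i=1}^n\alpha_i^{-1}\right)^{-1}$.
   Context: $\delta_x$ is the Dirac measure at $x$, and $\|\mu\|$ is the total mass of a Borel sub-probability measure $\mu$. For Borel probability measures $P_1,\dots,P_n$ on $\mathbb{R}$ and $j\in\mathbb{N}$, define the sub-probability measure $$\mu_j(P_1,\dots,P_n)=\sum_{k\in\mathbb{Z}}\ \prod_{i=1}^n P_i\big(((k-1)2^{-j},k2^{-j}]\big)\,\delta_{k2^{-j}}.$$ $P_1,\dots,P_n$ are compatible if $\|\mu_j(P_1,\dots,P_n)\|>0$ for all $j\in\mathbb{N}$. If $\mu_j(P_1,\dots,P_n)/\|\mu_j(P_1,\dots,P_n)\|$ converges vaguely, as $j\to\infty$, to a Borel probability measure $Q$, then $Q$ is called the conflation of $P_1,\dots,P_n$ and is written $\&(P_1,\dots,P_n)$. Vague convergence $\nu_j\to\nu$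 of sub-probability measures means $\int f\,d\nu_j\to\int f\,d\nu$ for all continuous $f$ vanishing at infinity. Families of distributions. A discrete probability distribution with probability mass function $p(\cdot)$ is: Bernoulli with parameter $p\in[0,1]$ if $p(1)=1-p(0)=p$; geometric with parameter $p\in[0,1]$ if $p(k)=(1-p)^{k-1}p$ for all $k\in\mathbb{N}$; discrete uniform on $\{1,\dots,m\}$ if $p(k)=1/m$ for $k\in\{1,\dots,m\}$; Zipf with parameters $\alpha>0$ and $m\in\mathbb{N}$ if $p(k)$ is proportional to $k^{-\alpha}$ for $k\in\{1,\dots,m\}$; Zeta with parameter $\alpha>1$ if $p(k)$ is proportional to $k^{-\alpha}$ for all $k\in\mathbb{N}$. An absolutely continuous probability distribution is: gamma with parameters $\alpha\in\mathbb{N}$, $\beta>0$ if its density is proportional to $x^{\alpha-1}e^{-x/\beta}$ for $x>0$; beta with parameters $\alpha>1$, $\beta>1$ if its density is proportional to $x^{\alpha-1}(1-x)^{\beta-1}$ for $0<x<1$; uniform on $(a,b)$, $a<b$, if its density is the constant $(b-a)^{-1}$ for $a<x<b$; (standard) LaPlace with parameter $\alpha>0$ if its density is proportional to $e^{-|x|/\alpha}$, $-\infty<x<\infty$; Pareto with parameters $\alpha>0$, $\beta>0$ if its density is proportional to $x^{-(\alpha+1)}$ for $\beta<x<\infty$; exponential with mean $\alpha>0$ if its density is proportional to $e^{-x/\alpha}$ for $x>0$. (Mass functions and densities vanish outside the indicated sets.)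
   Formalization: In (viii) it is additionally assumed that max a_i ≠ min b_i; without it the claim fails: U(0,1/3) and U(1/3,1) are compatible, but their conflation is the Dirac mass at 1/3 and the uniform law on (1/3,1/3) is undefined. *)

(* Defs.v *)
From HB Require Import structures.
From mathcomp Require Import all_boot all_order all_algebra.
From mathcomp Require Import all_classical all_reals all_analysis.

Set Implicit Arguments.
Unset Strict Implicit.
Unset Printing Implicit Defensive.

Import Order.TTheory GRing.Theory Num.Theory.
Import numFieldTopology.Exports numFieldNormedType.Exports.

Local Open Scope classical_set_scope.
Local Open Scope ring_scope.

Notation borel_prob R := (probability (measurableTypeR R) R).

Section conflation.
Context (R : realType).

Definition dyadic (j : nat) (k : int) : R := k%:~R / 2 ^+ j.

Definition dyadic_cell (j : nat) (k : int) : set (measurableTypeR R) :=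
  `]dyadic j (k - 1), dyadic j k]%classic.

Section discretized_product.
Context (n : nat) (P : 'I_n -> borel_prob R) (j : nat).
Local Open Scope ereal_scope.

Definition mu_ (A : set (measurableTypeR R)) : \bar R :=
  \esum_(k in [set: int])
    ((\prod_(i < n) P i (dyadic_cell j k)) * \d_(dyadic j k) A).

Let w_ge0 k : 0 <= \prod_(i < n) P i (dyadic_cell j k).
Proof. by apply: prode_ge0. Qed.

Let w_fin k : \prod_(i < n) P i (dyadic_cell j k) \is a fin_num.
Proof.
by apply: prode_fin_num => i _; apply: fin_num_measure; exact: measurable_itv.
Qed.

Let mu0 : mu_ set0 = 0.
Proof. by rewrite /mu_ esum1// => k _; rewrite measure0 mule0. Qed.

Let mu_ge0 A : 0 <= mu_ A.
Proof. by apply: esum_ge0 => k _; rewrite mule_ge0. Qed.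

Let mu_sigma_additive : semi_sigma_additive mu_.
Proof.
move=> F mF tF mUF.
suff -> : mu_ (\bigcup_n0 F n0) = \sum_(0 <= m <oo) mu_ (F m).
  by apply: is_cvg_ereal_nneg_natsum => m _; exact: mu_ge0.
rewrite nneseries_esumT; last by move=> m; exact: mu_ge0.
rewrite /mu_ [RHS]esum_esum; last by move=> m k; rewrite mule_ge0.
rewrite (_ : _ `*`` _ = [set: nat * int]); last first.
  by apply/seteqP; split.
rewrite (reindex_esum [set: int * nat] _ (fun x : int * nat => (x.2, x.1)));
  last first.
  split => //; first by move=> [? ?] [? ?] _ _ [-> ->].
  by move=> [m k] _; exists (k, m).
have -> : [set: int * nat] = [set: int] `*`` (fun=> [set: nat]).
  by apply/seteqP; split.
rewrite -(@esum_esum _ _ _ _ _ (fun k m =>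
    \prod_(i < n) P i (dyadic_cell j k) * \d_(dyadic j k) (F m)));
  last by move=> k m; rewrite mule_ge0.
apply: eq_esum => k _.
rewrite -nneseries_esumT; last by move=> m; rewrite mule_ge0.
rewrite -(fineK (w_fin k)) nneseriesZl //; congr (_ * _).
exact: measure_semi_bigcup.
Qed.

HB.instance Definition _ := isMeasure.Build _ _ _ mu_
  mu0 mu_ge0 mu_sigma_additive.

End discretized_product.

(* The natural numbers of the source start at 1; this also explains the ranges
   of [k] in the mass functions below. *)
Definition compatible (n : nat) (P : 'I_n -> borel_prob R) : Prop :=
  forall j : nat, (0 < j)%N -> (0 < mu_ P j [set: R])%E.

Definition C0 (f : R -> R) : Prop :=
  [/\ continuous f, f x @[x --> +oo%R] --> (0 : R)
    & f x @[x --> -oo%R] --> (0 : R)].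

Definition vague_cvg (nu : {measure set (measurableTypeR R) -> \bar R}^nat)
    (nu_lim : {measure set (measurableTypeR R) -> \bar R}) : Prop :=
  forall f : R -> R, C0 f ->
    (\int[nu j]_x (f x)%:E)%E @[j --> \oo] --> (\int[nu_lim]_x (f x)%:E)%E.

(* [mnormalize] divides by the total mass; its default value [\d_0] is only
   used for a zero mass, which compatibility excludes, or an infinite one,
   which cannot occur when [0 < n]. *)
Definition is_conflation (n : nat) (P : 'I_n -> borel_prob R)
    (Q : borel_prob R) : Prop :=
  vague_cvg (fun j => mnormalize (mu_ P j) \d_(0 : measurableTypeR R)) Q.

(* "The conflation of [P] is [D]": existence is asserted, and so is [D] for
   every vague limit, because uniqueness is not built into [is_conflation]. *)
Definition conflation_is (n : nat) (P : 'I_n -> borel_prob R)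
    (D : borel_prob R -> Prop) : Prop :=
  (exists Q, is_conflation P Q) /\ (forall Q, is_conflation P Q -> D Q).

(* All the discrete families live on the natural numbers, so their mass
   functions are given on [nat]. *)
Definition has_pmf (Q : borel_prob R) (p : nat -> R) : Prop :=
  (forall k : nat, Q [set k%:R] = (p k)%:E) /\
  Q (range (fun k : nat => k%:R : R)) = 1%E.

Definition has_pmf_propto (Q : borel_prob R) (p : nat -> R) : Prop :=
  exists2 c : R, 0 < c & has_pmf Q (fun k => c * p k).

Definition has_density (Q : borel_prob R) (f : R -> R) : Prop :=
  [/\ measurable_fun [set: measurableTypeR R] f, (forall x, 0 <= f x)
    & forall A : set (measurableTypeR R), measurable A ->
        Q A = (\int[lebesgue_measure]_(x in A) (f x)%:E)%E].

Definition has_density_propto (Q : borel_prob R) (f : R -> R) : Prop :=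
  exists2 c : R, 0 < c & has_density Q (fun x => c * f x).

Definition is_bernoulli (p : R) (Q : borel_prob R) : Prop :=
  0 <= p <= 1 /\
  has_pmf Q (fun k => if k == 1%N then p else if k == 0%N then 1 - p else 0).

Definition is_geometric (p : R) (Q : borel_prob R) : Prop :=
  0 <= p <= 1 /\
  has_pmf Q (fun k => if (1 <= k)%N then (1 - p) ^+ (k - 1) * p else 0).

Definition is_discrete_uniform (m : nat) (Q : borel_prob R) : Prop :=
  (1 <= m)%N /\
  has_pmf Q (fun k => if (1 <= k <= m)%N then m%:R^-1 else 0).

Definition is_zipf (alpha : R) (m : nat) (Q : borel_prob R) : Prop :=
  [/\ 0 < alpha, (1 <= m)%N & has_pmf_propto Q
    (fun k => if (1 <= k <= m)%N then k%:R `^ (- alpha) else 0)].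

Definition is_zeta (alpha : R) (Q : borel_prob R) : Prop :=
  1 < alpha /\
  has_pmf_propto Q (fun k => if (1 <= k)%N then k%:R `^ (- alpha) else 0).

Definition is_gamma (alpha : nat) (beta : R) (Q : borel_prob R) : Prop :=
  [/\ (1 <= alpha)%N, 0 < beta & has_density_propto Q
    (fun x => if 0 < x then x ^+ (alpha - 1) * expR (- x / beta) else 0)].

Definition is_beta (alpha beta : R) (Q : borel_prob R) : Prop :=
  [/\ 1 < alpha, 1 < beta & has_density_propto Q
    (fun x => if 0 < x < 1 then x `^ (alpha - 1) * (1 - x) `^ (beta - 1)
              else 0)].

Definition is_uniform (a b : R) (Q : borel_prob R) : Prop :=
  a < b /\ has_density Q (fun x => if a < x < b then (b - a)^-1 else 0).

Definition is_laplace (alpha : R) (Q : borel_prob R) : Prop :=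
  0 < alpha /\ has_density_propto Q (fun x => expR (- `|x| / alpha)).

Definition is_pareto (alpha beta : R) (Q : borel_prob R) : Prop :=
  [/\ 0 < alpha, 0 < beta & has_density_propto Q
    (fun x => if beta < x then x `^ (- (alpha + 1)) else 0)].

Definition is_exponential (alpha : R) (Q : borel_prob R) : Prop :=
  0 < alpha /\ has_density_propto Q
    (fun x => if 0 < x then expR (- x / alpha) else 0).

End conflation.

Definition minn_fam (n : nat) (m : 'I_n.+1 -> nat) : nat :=
  \big[minn/m ord0]_(i < n.+1) m i.

Definition min_fam (R : realType) (n : nat) (b : 'I_n.+1 -> R) : R :=
  \big[Num.min/b ord0]_(i < n.+1) b i.

Definition max_fam (R : realType) (n : nat) (a : 'I_n.+1 -> R) : R :=
  \big[Num.max/a ord0]_(i < n.+1) a i.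

(* Main.v *)
Require Import Defs.
From HB Require Import structures.
From mathcomp Require Import all_boot all_order all_algebra.
From mathcomp Require Import all_classical all_reals all_analysis.
From mathcomp Require Import measurable_realfun.
From mathcomp Require Import lebesgue_integral_differentiation.
From mathcomp Require Import ring lra.
Import Order.TTheory GRing.Theory Num.Theory.
Import numFieldTopology.Exports numFieldNormedType.Exports.
Local Open Scope classical_set_scope.
Local Open Scope ring_scope.

Set Implicit Arguments.
Unset Strict Implicit.
Unset Printing Implicit Defensive.

(** Conflation multiplies mass functions, and multiplies densities; each family
    is closed under these products up to a normalizing constant.

    Let [c_j x] be the right end point of the level-[j] dyadic cell containing
    [x], and [w_j x] the product of the masses that all measures but the first
    give to this cell. Then the discretized product [mu_ P j] is the image under
    [c_j] of the first measure [P ord0] weighted by [w_j] ([mu_integral]). Taking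
    [P ord0] as the reference measure makes bounded convergence available: if
    [a_j w_j] is bounded uniformly in [j] and converges to [W] almost everywhere
    for [P ord0], then [a_j] times the integral of a bounded continuous [f]
    against [mu_ P j] converges to the integral of [f W] against [P ord0].
    Dividing by the case [f = 1], the normalized measures converge vaguely to
    the probability measure with density [W / Z] with respect to [P ord0], where
    [Z] is the integral of [W] ([conflation_weighted]). Vague limits are unique
    ([C0_integral_unique]), so that every conflation is this measure.

    For measures carried by the natural numbers, [w_j] does not depend on [j] at
    the natural numbers, and one takes [a_j = 1]: the limit has mass function
    proportional to the product ([conflation_pmf]). For measures with bounded
    densities [f_i], Lebesgue differentiation shows that [2 ^ j] times the mass
    of the cell around [x] converges to [f_i x] for almost every [x], so that
    with [a_j = 2 ^ (j n)] the limit [W] is the product of all densities but the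
    first, and the conflation has density proportional to the full product
    ([conflation_density]).

    What remains in each family is to identify the product, to bound the
    densities and to check that their product has positive integral. For uniform
    distributions the latter uses compatibility, which forces the maximum of the
    left end points not to exceed the minimum of the right ones. *)

(** * Dyadic cells *)

(** The index [k] of the level-[j] dyadic cell containing [x]. *)
Definition cell_index {R : realType} (j : nat) (x : R) : int :=
  Num.ceil (x * 2 ^+ j).

(** The right end point of the level-[j] dyadic cell containing [x]. *)
Definition cell_end {R : realType} (j : nat) (x : R) : R :=
  dyadic R j (cell_index j x).

(** The product of the masses that all measures but the first give to the
    level-[j] dyadic cell containing [x]; a step function of [x]. *)
Definition cell_weight {R : realType} {n : nat} (P : 'I_n.+1 -> borel_prob R)
    (j : nat) (x : R) : R :=
  \prod_(i < n) fine (P (lift ord0 i) (dyadic_cell j (cell_index j x))).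

Section cells.
Context {R : realType}.

Lemma dyadic_cellP j k (x : R) : dyadic_cell j k x <-> cell_index j x = k.
Proof.
have j0 : (0 : R) < 2 ^+ j by rewrite exprn_gt0.
rewrite /dyadic_cell /dyadic /= in_itv/= ltr_pdivrMr// ler_pdivlMr//.
rewrite -ceil_eq /cell_index; split; first by move=> /eqP.
by move=> ->.
Qed.

Lemma measurable_dyadic_cell j k : measurable (@dyadic_cell R j k).
Proof. exact: measurable_itv. Qed.

Lemma cell_end_bounds j (x : R) : x <= cell_end j x < x + 2 ^- j.
Proof.
have j0 : (0 : R) < 2 ^+ j by rewrite exprn_gt0.
rewrite /cell_end /dyadic -(ler_pM2r j0) -(ltr_pM2r j0) divfK ?gt_eqF//.
have /andP[h ->] := ceil_itv (x * 2 ^+ j).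
by rewrite /= mulrDl mulVf ?gt_eqF// -ltrBlDr -[1]/(1%:~R) -intrB.
Qed.

Lemma cvg_inv_expr2 : (2 ^- j : R) @[j --> \oo] --> (0 : R).
Proof.
under eq_fun do rewrite -exprVn.
by apply: cvg_expr; rewrite ger0_norm ?invr_ge0// invf_lt1// ltr1n.
Qed.

(** An enumeration of the integers, which turns sums over dyadic cells into
    series. *)
Definition int_of_index (m : nat) : int :=
  if odd m then Negz m./2 else Posz m./2.

Lemma int_of_index_bij : set_bij [set: nat] [set: int] int_of_index.
Proof.
split => //.
- move=> a b _ _; rewrite /int_of_index => h.
  rewrite -[a]odd_double_half -[b]odd_double_half; move: h.
  by case: odd; case: odd => //= -[->].
- move=> [m|m] _ /=.
    by exists m.*2 => //; rewrite /int_of_index odd_double doubleK.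
  by exists m.*2.+1 => //; rewrite /int_of_index /= odd_double /= uphalf_double.
Qed.

Lemma trivIset_dyadic_cell j :
  trivIset setT (fun m => @dyadic_cell R j (int_of_index m)).
Proof.
apply/trivIsetP => a b _ _ ab; apply/seteqP; split => // x [].
move=> /dyadic_cellP xa /dyadic_cellP xb.
have [_ inj _] := int_of_index_bij.
by move/eqP: ab; apply; apply: inj; rewrite ?inE// -xa.
Qed.

Lemma measurable_cell_fun d (T : measurableType d) j (h : int -> T) :
  measurable_fun [set: measurableTypeR R] (fun x => h (cell_index j x)).
Proof.
move=> _ Y mY; rewrite setTI.
rewrite (_ : _ @^-1` _ = \bigcup_m (if h (int_of_index m) \in Y then
  dyadic_cell j (int_of_index m) else set0)).
  apply: bigcup_measurable => m _; case: ifPn => // _.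
  exact: measurable_dyadic_cell.
apply/seteqP; split => x /=.
  move=> Yx; have [_ _ /(_ (cell_index j x) I)[m _ mE]] := int_of_index_bij.
  by exists m => //; rewrite mE mem_set//; apply/dyadic_cellP.
by move=> [m _]; case: ifPn => // /set_mem mY' /dyadic_cellP ->.
Qed.

Lemma measurable_cell_end j :
  measurable_fun [set: measurableTypeR R] (cell_end j : R -> measurableTypeR R).
Proof. exact: (@measurable_cell_fun _ (measurableTypeR R) j (dyadic R j)). Qed.

Section product.
Context (n : nat) (P : 'I_n.+1 -> borel_prob R).

Lemma measurable_cell_weight j :
  measurable_fun [set: measurableTypeR R] (cell_weight P j).
Proof.
exact: (@measurable_cell_fun _ _ j (fun k =>
  \prod_(i < n) fine (P (lift ord0 i) (dyadic_cell j k)))).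
Qed.

Lemma cell_weight_ge0 j x : 0 <= cell_weight P j x.
Proof. by apply: prodr_ge0 => i _; exact: fine_ge0. Qed.

Lemma fine_prob_le1 (Q : borel_prob R) A : measurable A -> fine (Q A) <= 1.
Proof.
move=> mA; rewrite -lee_fin fineK; first exact: probability_le1.
exact: fin_num_measure.
Qed.

Lemma cell_weight_le1 j x : cell_weight P j x <= 1.
Proof.
apply: prodr_ile1 => i _.
by rewrite fine_ge0//= fine_prob_le1//; exact: measurable_dyadic_cell.
Qed.

Local Open Scope ereal_scope.

(** The discretized product is the image, under rounding up to the dyadic grid,
    of [P ord0] weighted by [cell_weight]. *)
Lemma mu_integral j (A : set (measurableTypeR R)) : measurable A ->
  mu_ P j A = \int[P ord0]_(x in cell_end j @^-1` A) (cell_weight P j x)%:E.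
Proof.
move=> mA.
pose F m := dyadic_cell j (int_of_index m) `&` (cell_end j @^-1` A).
have mcA : measurable (cell_end j @^-1` A).
  by rewrite -[X in measurable X]setTI; exact: measurable_cell_end.
have -> : cell_end j @^-1` A = \bigcup_m F m.
  rewrite -setI_bigcupl; apply/seteqP; split => [x Ax|x []//]; split => //.
  have [_ _ /(_ (cell_index j x) Logic.I)[m _ mE]] := int_of_index_bij.
  by exists m => //; apply/dyadic_cellP.
rewrite ge0_integral_bigcup; last 4 first.
- by move=> m; apply: measurableI => //; exact: measurable_dyadic_cell.
- by apply/measurable_EFinP/measurable_funTS; exact: measurable_cell_weight.
- by move=> x _; rewrite lee_fin cell_weight_ge0.
- by apply: trivIset_setIr; exact: trivIset_dyadic_cell.
rewrite nneseries_esumT; last first.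
  by move=> m; apply: integral_ge0 => x _; rewrite lee_fin cell_weight_ge0.
rewrite /mu_ (reindex_esum _ _ _ _ int_of_index_bij).
apply: eq_esum => m _; set k := int_of_index m.
transitivity (\int[P ord0]_(x in F m)
    (\prod_(i < n) fine (P (lift ord0 i) (dyadic_cell j k)))%:E).
  rewrite integral_cst/=; last first.
    by apply: measurableI => //; exact: measurable_dyadic_cell.
  rewrite big_ord_recl -prodEFin muleAC [in RHS]muleC; congr (_ * _)%E.
    (* [F m] is the whole cell if its right end point lies in [A], and is empty
       otherwise. *)
    rewrite diracE; have [Ak|Ak] := boolP (dyadic R j k \in A).
      rewrite mule1; congr (P ord0 _); apply/seteqP; split => [x kx|x []//].
      split => //=; move/dyadic_cellP: kx => kx.
      by rewrite /cell_end kx -inE.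
    rewrite mule0 (_ : F m = set0) ?measure0//; apply/seteqP; split => // x [].
    by move=> /dyadic_cellP kx; rewrite /= /cell_end kx -in_setE (negbTE Ak).
  apply: eq_bigr => i _; rewrite fineK// fin_num_measure//.
  exact: measurable_dyadic_cell.
apply: eq_integral => x /set_mem[/dyadic_cellP kx _].
by rewrite /cell_weight kx.
Qed.
End product.
End cells.

(** * Measures given by a density *)

Lemma integrable_bounded d (T : measurableType d) (R : realType)
    (mu : {finite_measure set T -> \bar R}) (A : set T) (f : T -> R) (K : R) :
  measurable A -> measurable_fun [set: T] f -> (forall x, `|f x| <= K) ->
  mu.-integrable A (EFin \o f).
Proof.
move=> mA mf fK; apply: measurable_bounded_integrable => //.
- by rewrite -ge0_fin_numE// fin_num_measure.
- exact: measurable_funTS.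
- exists K; split; first exact: num_real.
  by move=> M KM x _; exact/(le_trans (fK x))/ltW.
Qed.

Section density.
Context d (T : measurableType d) (R : realType).
Context (mu : {sigma_finite_measure set T -> \bar R})
  (nu : {finite_measure set T -> \bar R}) (g : T -> R).
Hypothesis mg : measurable_fun [set: T] g.
Hypothesis nuE : forall A, measurable A ->
  nu A = (\int[mu]_(x in A) (g x)%:E)%E.
Local Open Scope ereal_scope.

Lemma density_dominates : nu `<< mu.
Proof.
apply/null_content_dominatesP => A mA muA; rewrite nuE//.
rewrite null_set_integral//; apply/measurable_EFinP.
exact: measurable_funTS.
Qed.

(** Integration against a finite measure with density [g]. *)
Lemma integral_density (E : set T) (f : T -> \bar R) :
  measurable E -> nu.-integrable E f ->
  \int[nu]_(x in E) f x = \int[mu]_(x in E) (f x * (g x)%:E).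
Proof.
move=> mE fi; rewrite -(Radon_Nikodym_change_of_variables density_dominates)//.
have mf : measurable_fun E f by case/integrableP : fi.
pose nu' := charge_of_finite_measure nu.
have iRN := @Radon_Nikodym_integrable _ _ _ nu' mu density_dominates.
have mRN : measurable_fun E (Radon_Nikodym nu' mu).
  apply: measurable_funTS.
  exact: (measurable_int _ iRN).
apply: ae_eq_integral => //; [exact: emeasurable_funM| |].
  by apply: emeasurable_funM => //; apply/measurable_EFinP/measurable_funTS.
apply: ae_eqe_mul2l; apply: integral_ae_eq => //.
- apply: integrableS iRN => //.
- by apply/measurable_EFinP/measurable_funTS.
- move=> A AE mA; rewrite -(@Radon_Nikodym_integral _ _ _ nu' mu)//.
    exact: nuE.
  exact: density_dominates.
Qed.

End density.

Section weighted_measure.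
Context d (T : measurableType d) (R : realType).
Context (mu : {measure set T -> \bar R}) (w : T -> R).
Local Open Scope ereal_scope.

(** The measure with density [w] with respect to [mu]. The two proofs are
    arguments because they are what makes this set function a measure. *)
Definition weighted of measurable_fun [set: T] w & (forall x, (0 <= w x)%R) :=
  fun A : set T => \int[mu]_(x in A) (w x)%:E.

Context (mw : measurable_fun [set: T] w) (w0 : forall x, (0 <= w x)%R).

Let weighted0 : weighted mw w0 set0 = 0.
Proof. exact: integral_set0. Qed.

Let weighted_ge0 A : 0 <= weighted mw w0 A.
Proof. by apply: integral_ge0 => x _; rewrite lee_fin. Qed.

Let weighted_sigma_additive : semi_sigma_additive (weighted mw w0).
Proof.
apply: semi_sigma_additive_nng_induced; first exact/measurable_EFinP.
by move=> x; rewrite lee_fin.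
Qed.

HB.instance Definition _ := isMeasure.Build _ _ _ (weighted mw w0)
  weighted0 weighted_ge0 weighted_sigma_additive.

End weighted_measure.

Lemma mnormalizeE d (T : measurableType d) (R : realType)
    (m : {measure set T -> \bar R}) (Q : probability T R) (A : set T) :
  (0 < m [set: T])%E -> m [set: T] \is a fin_num ->
  mnormalize m Q A = (m A * (fine (m [set: T]))^-1%:E)%E.
Proof.
move=> m0; rewrite /mnormalize gt_eqF//= fin_numE => /andP[_].
by case: ifPn => // ->.
Qed.

Lemma weighted_probabilityE d (T : measurableType d) (R : realType)
    (mu Q : probability T R) (w : T -> R) (K : R)
    (mw : measurable_fun [set: T] w) (w0 : forall x, 0 <= w x) :
  (forall x, w x <= K) -> (0 < \int[mu]_x (w x)%:E)%E ->
  forall A, measurable A ->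
  mnormalize (weighted mu mw w0) Q A =
  (\int[mu]_(x in A) (w x / fine (\int[mu]_x (w x)%:E)%E)%:E)%E.
Proof.
move=> wK Z0 A mA; set Z := fine _.
have iw B : measurable B -> mu.-integrable B (EFin \o w).
  move=> mB; apply: (@integrable_bounded _ _ _ _ _ _ K) => // x.
  by rewrite ger0_norm.
have Zfin : (\int[mu]_x (w x)%:E)%E \is a fin_num.
  exact: integrable_fin_num (iw _ _).
rewrite mnormalizeE//= /weighted.
under [RHS]eq_integral do rewrite EFinM.
by rewrite integralZr//; exact: iw.
Qed.

(** * Uniqueness of vague limits *)

Section C0_functions.
Context {R : realType}.

Lemma C0_bounded (f : R -> R) : C0 f -> exists K, forall x, `|f x| <= K.
Proof.
move=> [cf /cvgr_norm_lt fp /cvgr_norm_lt fn].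
have := fp 1; rewrite normr0 => /(_ ltr01)[M [_ fM]].
have := fn 1; rewrite normr0 => /(_ ltr01)[N [_ fN]].
have cpt : compact (f @` `[N, M]).
  apply: continuous_compact; last exact: segment_compact.
  exact: continuous_subspaceT.
have [B [_ /(_ (`|B| + 1))fB]] := compact_bounded cpt.
exists (`|B| + 1) => x.
have B1 : 1 <= `|B| + 1 :> R by rewrite lerDr.
have [xM|xM] := ltP M x; first exact: le_trans (ltW (fM _ xM)) B1.
have [xN|xN] := ltP x N; first exact: le_trans (ltW (fN _ xN)) B1.
apply: fB; first by rewrite ltr_pwDr// ler_norm.
by exists x => //=; rewrite in_itv/= xN xM.
Qed.

(** Continuous compactly supported functions which converge pointwise, as [m]
    tends to infinity, to the indicator of the half-open interval ]a, b]. *)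
Definition bump (a b : R) (m : nat) (x : R) : R :=
  Num.max 0 (Num.min 1
    (Num.min (m.+1%:R * (x - a)) (1 - m.+1%:R * (x - b)))).

Lemma bump_ge0_le1 a b m x : 0 <= bump a b m x <= 1.
Proof.
by rewrite /bump le_max lexx/= ge_max ler01 ge_min lexx.
Qed.

Lemma bump_left a b m x : x <= a -> bump a b m x = 0.
Proof.
move=> xa; apply/max_idPl; rewrite ge_min; apply/orP; right.
by rewrite ge_min pmulr_rle0// subr_le0 xa.
Qed.

Lemma bump_right a b m x : b + m.+1%:R^-1 <= x -> bump a b m x = 0.
Proof.
move=> bx; apply/max_idPl; rewrite ge_min; apply/orP; right.
rewrite ge_min; apply/orP; right.
by rewrite subr_le0 -ler_pdivrMl// mulr1 lerBrDl.
Qed.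

Lemma bump_mid a b m x : a + m.+1%:R^-1 <= x -> x <= b -> bump a b m x = 1.
Proof.
move=> ax xb; rewrite /bump (min_idPl _) ?(max_idPr _)//.
rewrite le_min -ler_pdivrMl// mulr1 lerBrDl ax /= lerBrDl gerDr.
by rewrite pmulr_rle0// subr_le0.
Qed.

Lemma bump_C0 a b m : C0 (bump a b m).
Proof.
split.
- move=> x.
  apply: (@continuous_max _ _ (cst 0) (fun x => Num.min 1 (Num.min _ _))).
    exact: cvg_cst.
  apply: (@continuous_min _ _ (cst 1) (fun x => Num.min _ _)).
    exact: cvg_cst.
  apply: (@continuous_min _ _ (fun x => m.+1%:R * (x - a))
    (fun x => 1 - m.+1%:R * (x - b))).
    by apply: cvgM; [exact: cvg_cst|apply: cvgB => //; exact: cvg_cst].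
  apply: cvgB; first exact: cvg_cst.
  by apply: cvgM; [exact: cvg_cst|apply: cvgB => //; exact: cvg_cst].
- apply: cvg_near_cst; near=> x; apply: bump_right.
  by near: x; apply: nbhs_pinfty_ge; exact: num_real.
- apply: cvg_near_cst; near=> x; apply: bump_left.
  by near: x; apply: nbhs_ninfty_le; exact: num_real.
Unshelve. all: by end_near. Qed.

Lemma bump_cvg_indic a b (x : R) :
  bump a b m x @[m --> \oo] --> (\1_(`]a, b]%classic : set R) x : R).
Proof.
rewrite indicE; have [xa|ax] := leP x a.
  rewrite memNset/= ?in_itv/=; last by rewrite ltNge xa.
  by apply: cvg_near_cst; apply: nearW => m; exact: bump_left.
have [xb|bx] := leP x b.
  rewrite mem_set/= ?in_itv/= ?ax ?xb//.
  have xa0 : 0 < x - a by rewrite subr_gt0.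
  apply: cvg_near_cst; near=> m; apply: bump_mid => //.
  rewrite -lerBrDl; apply: ltW; near: m.
  exact: (near_infty_natSinv_lt (PosNum xa0)).
rewrite memNset/= ?in_itv/= ?ax; last by rewrite leNgt bx.
have xb0 : 0 < x - b by rewrite subr_gt0.
apply: cvg_near_cst; near=> m; apply: bump_right => //.
rewrite -lerBrDl; apply: ltW; near: m.
exact: (near_infty_natSinv_lt (PosNum xb0)).
Unshelve. all: by end_near. Qed.

Lemma C0_measurable (f : R -> R) :
  C0 f -> measurable_fun [set: measurableTypeR R] f.
Proof. by move=> [cf _ _]; exact: continuous_measurable_fun. Qed.

Lemma C0_integrable (f : R -> R) (Q : borel_prob R) : C0 f ->
  Q.-integrable setT (EFin \o f).
Proof.
move=> f0; have [K fK] := C0_bounded f0.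
apply: (@integrable_bounded _ _ _ _ _ _ K) => //; exact: C0_measurable.
Qed.

(** Vague limits are unique: the functions [bump] determine the measure of the
    half-open intervals, which form a pi-system generating the Borel sets. *)
Lemma C0_integral_unique (Q1 Q2 : borel_prob R) :
  (forall f : R -> R, C0 f -> \int[Q1]_x (f x)%:E = \int[Q2]_x (f x)%:E)%E ->
  forall A : set (measurableTypeR R), measurable A -> Q1 A = Q2 A.
Proof.
move=> Q12.
have bumpE (Q : borel_prob R) a b :
  (\int[Q]_x (bump a b m x)%:E)%E @[m --> \oo] --> Q `]a, b]%classic.
  set I : set (measurableTypeR R) := `]a, b]%classic.
  have mb m : measurable_fun [set: measurableTypeR R]
      (fun x => (bump a b m x)%:E).
    by apply/measurable_EFinP; exact: C0_measurable (bump_C0 a b m).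
  have mi : measurable_fun [set: measurableTypeR R]
      (fun x => (\1_I x : R)%:E).
    by apply/measurable_EFinP; apply: measurable_indic; exact: measurable_itv.
  have cvgI : {ae Q, forall x, [set: R] x ->
      (bump a b m x)%:E @[m --> \oo] --> (\1_I x)%:E}.
    apply: aeW => x _; apply/fine_cvgP; split; first exact: nearW.
    exact: bump_cvg_indic.
  have i1 : Q.-integrable [set: measurableTypeR R] (cst 1%E).
    exact: finite_measure_integrable_cst.
  have le1 : {ae Q, forall x m, [set: R] x -> (`|(bump a b m x)%:E| <= cst 1 x)%E}.
    apply: aeW => x m _; have /andP[b0 b1] := bump_ge0_le1 a b m x.
    by rewrite lee_fin ger0_norm.
  have [_ _] := dominated_convergence measurableT mb mi cvgI i1 le1.
  rewrite integral_indic ?setIT//; exact: measurable_itv.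
apply: (@measure_unique _ R (measurableTypeR R) (@ocitv R)
  (fun n => `](- n%:R), n%:R]%classic)).
- done.
- exact: ocitvI.
- by move=> i; exact: is_ocitv.
- apply/seteqP; split => // x _; exists (Num.bound `|x|) => //=.
  have := archi_boundP (normr_ge0 x); rewrite ltr_norml in_itv/=.
  by move=> /andP[-> /ltW].
- move=> A [[a b] _ <-] /=.
  have := bumpE Q2 a b.
  rewrite (_ : (fun m => _) = fun m => (\int[Q1]_x (bump a b m x)%:E)%E).
    by move=> h; exact: (cvg_unique (@ereal_hausdorff R) (bumpE Q1 a b) h).
  by apply/funext => m; rewrite Q12//; exact: bump_C0.
- move=> k; apply: le_lt_trans (ltry 1); rewrite probability_le1//.
Qed.

End C0_functions.

(** * The limit of the discretized products *)

Section normalized_mu.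
Context {R : realType} (n : nat) (P : 'I_n.+1 -> borel_prob R).
Local Notation P0 := (P ord0).

Lemma cell_end_cvg (x : R) : cell_end j x @[j --> \oo] --> x.
Proof.
apply/cvgrPdist_lt => e e0; near=> j.
have /andP[xc cx] := cell_end_bounds j x.
rewrite distrC ger0_norm ?subr_ge0// ltrBlDl (lt_trans cx)// ltrD2l.
near: j.
have /cvgrPdist_lt /(_ e e0) := @cvg_inv_expr2 R; apply: filterS => j.
by rewrite sub0r normrN ger0_norm// invr_ge0 exprn_ge0.
Unshelve. all: by end_near. Qed.

Lemma integrable_cell (f : R -> R) (K c : R) j :
  measurable_fun [set: measurableTypeR R] f -> (forall x, `|f x| <= K) ->
  P0.-integrable [set: measurableTypeR R]
    (fun x => (f (cell_end j x) * (c * cell_weight P j x))%:E).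
Proof.
move=> mf fK; apply: (@integrable_bounded _ _ _ _ _ _ (K * `|c|)) => //.
  apply: measurable_funM.
    exact: (measurableT_comp mf (measurable_cell_end j)).
  by apply: measurable_funM => //; exact: measurable_cell_weight.
move=> x; rewrite normrM ler_pM// normrM ler_piMr//.
by rewrite ger0_norm ?cell_weight_ge0// cell_weight_le1.
Qed.

(** Integration against the normalized discretized product; the factor [c]
    cancels, and is there to absorb the decay of the weights in [j]. *)
Lemma integral_normalized_mu (f : R -> R) (K c : R) j : 0 < c ->
  measurable_fun [set: measurableTypeR R] f -> (forall x, `|f x| <= K) ->
  (0 < mu_ P j [set: measurableTypeR R])%E ->
  (\int[mnormalize (mu_ P j) \d_(0%R : measurableTypeR R)]_x (f x)%:E =
   \int[P0]_x (f (cell_end j x) * (c * cell_weight P j x))%:E *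
   (fine (\int[P0]_x (1 * (c * cell_weight P j x))%:E))^-1%:E)%E.
Proof.
move=> c0 mf fK Z0.
pose w := cell_weight P j.
have mw : measurable_fun [set: measurableTypeR R] w := measurable_cell_weight P j.
have w0 := cell_weight_ge0 P j : forall x, 0 <= w x.
have ZE : mu_ P j [set: measurableTypeR R] = (\int[P0]_x (w x)%:E)%E.
  by rewrite mu_integral.
have iw : P0.-integrable [set: measurableTypeR R] (EFin \o w).
  have := @integrable_cell (cst 1) 1 1 j; rewrite /comp.
  under eq_fun do rewrite !mul1r.
  by apply => // x; rewrite normr1.
have Zfin : (\int[P0]_x (w x)%:E)%E \is a fin_num.
  exact: integrable_fin_num iw.
have [Q QN] : exists Q : borel_prob R,
    forall A, Q A = mnormalize (weighted P0 mw w0) P0 A.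
  by exists (mnormalize (weighted P0 mw w0) P0).
pose Z := fine (\int[P0]_x (w x)%:E)%E.
have Zgt0 : 0 < Z by rewrite /Z fine_gt0// -ZE Z0 ZE ltey_eq Zfin.
have QE A : measurable A -> Q A = (\int[P0]_(x in A) (w x / Z)%:E)%E.
  rewrite QN; apply: (@weighted_probabilityE _ _ _ _ _ _ 1) => //; last by rewrite -ZE.
  exact: cell_weight_le1.
have iQ : Q.-integrable [set: measurableTypeR R] (EFin \o (f \o cell_end j)).
  apply: (@integrable_bounded _ _ _ Q _ _ K) => //; last by move=> x; exact: fK.
  exact: (measurableT_comp mf (measurable_cell_end j)).
have mfE : measurable_fun [set: measurableTypeR R] (EFin \o f).
  exact/measurable_EFinP.
transitivity (\int[Q]_x (f (cell_end j x))%:E)%E.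
  (* The normalized product is the image of [Q] under [cell_end j]. *)
  have e := integral_pushforward (measurable_cell_end j) mfE iQ measurableT.
  rewrite -[RHS]e.
  apply: eq_measure_integral; first exact: measurable_cell_end.
  move=> mc A mA _; rewrite /= /pushforward.
  have [mc0 mcfin] : (0 < mu_ P j [set: measurableTypeR R])%E /\
      mu_ P j [set: measurableTypeR R] \is a fin_num by rewrite ZE -{1}ZE.
  rewrite QN [LHS]mnormalizeE// [in RHS]mnormalizeE ?/= ?/weighted -/w -?ZE//.
  by rewrite mu_integral.
have mg : measurable_fun [set: measurableTypeR R] (fun x => w x / Z).
  by apply: measurable_funM.
rewrite (integral_density mg QE measurableT iQ).
rewrite -integralZr//; last exact: integrable_cell.
apply: eq_integral => x _ /=; rewrite -!EFinM; congr (_%:E).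
under eq_integral do rewrite mul1r EFinM.
rewrite integralZl//= fineM// -/Z -/w invfM /=.
by field; rewrite !gt_eqF.
Qed.

End normalized_mu.

Section conflation_limit.
Context {R : realType} (n : nat) (P : 'I_n.+1 -> borel_prob R).
Local Notation P0 := (P ord0).
Context (a : nat -> R) (W : R -> R) (C : R).
Hypotheses (a_gt0 : forall j, 0 < a j)
  (aw_le : forall j x, a j * cell_weight P j x <= C)
  (aw_cvg : {ae P0, forall x,
    a j * cell_weight P j x @[j --> \oo] --> (W x : R)})
  (mW : measurable_fun [set: measurableTypeR R] W)
  (W_ge0 : forall x, 0 <= W x) (W_le : forall x, W x <= C)
  (W_gt0 : (0 < \int[P0]_x (W x)%:E)%E).
Local Notation Z := (fine (\int[P0]_x (W x)%:E)%E).

(* [a j] times the unnormalized integral of [f] against the discretized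
   product. *)
Let scaled_integral (f : R -> R) (j : nat) : \bar R :=
  (\int[P0]_x (f (cell_end j x) * (a j * cell_weight P j x))%:E)%E.

Lemma scaled_integral_cvg (f : R -> R) (K : R) :
  continuous f -> (forall x, `|f x| <= K) ->
  fine (scaled_integral f j) @[j --> \oo] -->
    fine (\int[P0]_x (f x * W x)%:E)%E.
Proof.
move=> cf fK.
have mf : measurable_fun [set: measurableTypeR R] f := continuous_measurable_fun cf.
have C0 : 0 <= C := le_trans (W_ge0 0) (W_le 0).
have mj j : measurable_fun [set: measurableTypeR R]
    (fun x => (f (cell_end j x) * (a j * cell_weight P j x))%:E).
  exact: (measurable_int _ (integrable_cell P (a j) j mf fK)).
have ml : measurable_fun [set: measurableTypeR R] (fun x => (f x * W x)%:E).
  by apply/measurable_EFinP; exact: measurable_funM.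
have cvgf : {ae P0, forall x, [set: R] x ->
    (f (cell_end j x) * (a j * cell_weight P j x))%:E @[j --> \oo] -->
    (f x * W x)%:E}.
  move: aw_cvg; apply: filterS; first exact: (ae_filter_ringOfSetsType P0).
  move=> x awx _.
  apply/fine_cvgP; split; first exact: nearW.
  apply: cvgM awx; apply: continuous_cvg; [exact: cf|exact: cell_end_cvg].
have i1 : P0.-integrable [set: measurableTypeR R] (cst (K * C)%:E).
  exact: finite_measure_integrable_cst.
have le1 : {ae P0, forall x j, [set: R] x ->
    (`|(f (cell_end j x) * (a j * cell_weight P j x))%:E| <= cst (K * C)%:E x)%E}.
  apply: aeW => x j _; rewrite lee_fin normrM ler_pM// ger0_norm//.
  by rewrite mulr_ge0 ?cell_weight_ge0// ltW.
have [il _ h] := dominated_convergence measurableT mj ml cvgf i1 le1.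
apply: fine_cvg; rewrite fineK; first exact: h.
exact: integrable_fin_num il.
Qed.

(** If suitable multiples of the weights converge boundedly to [W], almost
    everywhere for the first measure, then the conflation has density [W / Z]
    with respect to the first measure. *)
Lemma conflation_weighted : conflation_is P (fun Q =>
  forall A : set (measurableTypeR R), measurable A ->
    Q A = (\int[P0]_(x in A) (W x / Z)%:E)%E).
Proof.
have iW (f : R -> R) (K : R) : measurable_fun [set: measurableTypeR R] f ->
    (forall x, `|f x| <= K) ->
    P0.-integrable [set: measurableTypeR R] (fun x => (f x * W x)%:E).
  move=> mf fK; apply: (@integrable_bounded _ _ _ P0 _ (fun x => f x * W x) (K * C)) => //.
    exact: measurable_funM.
  by move=> x; rewrite normrM ler_pM// ger0_norm.
have Zfin : (\int[P0]_x (W x)%:E)%E \is a fin_num.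
  apply: integrable_fin_num => //; have := @iW (cst 1) 1.
  by under eq_fun do rewrite mul1r; apply => // x; rewrite normr1.
have Z0 : 0 < Z by rewrite fine_gt0// W_gt0 ltey_eq Zfin.
have [Q QN] : exists Q : borel_prob R,
    forall A, Q A = mnormalize (weighted P0 mW W_ge0) P0 A.
  by exists (mnormalize (weighted P0 mW W_ge0) P0).
have QE A : measurable A -> Q A = (\int[P0]_(x in A) (W x / Z)%:E)%E.
  by move=> mA; rewrite QN; exact: (@weighted_probabilityE _ _ _ _ _ _ C).
have mg : measurable_fun [set: measurableTypeR R] (fun x => W x / Z).
  exact: measurable_funM.
have one1 (x : R) : `|cst 1 x : R| <= 1 by rewrite normr1.
have Z_cvg := scaled_integral_cvg (@cst_continuous _ _ (1 : R)) one1.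
have ZE : fine (\int[P0]_x (cst 1 x * W x)%:E)%E = Z.
  by under eq_integral do rewrite mul1r.
rewrite ZE in Z_cvg.
(* The masses are eventually positive, as [a j] times the mass tends to [Z]. *)
have mu_gt0 : \forall j \near \oo, (0 < mu_ P j [set: measurableTypeR R])%E.
  have : \forall j \near \oo, 0 < fine (scaled_integral (cst 1) j).
    exact: (cvgr_gt _ Z_cvg).
  apply: filterS => j.
  rewrite mu_integral// preimage_setT lt0e.
  rewrite integral_ge0 ?andbT; last by move=> x _; rewrite lee_fin cell_weight_ge0.
  apply: contraTneq => w0.
  rewrite /scaled_integral.
  under eq_integral do rewrite mul1r EFinM.
  rewrite ge0_integralZl ?w0 ?mule0 ?ltxx//.
  - by apply/measurable_EFinP; exact: measurable_cell_weight.
  - by move=> x _; rewrite lee_fin cell_weight_ge0.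
  - by rewrite lee_fin ltW.
have conf : is_conflation P Q.
  move=> f f0; have [K fK] := C0_bounded f0.
  have mf := C0_measurable f0.
  rewrite (integral_density mg QE measurableT (C0_integrable Q f0)).
  have -> : (\int[P0]_x ((EFin \o f) x * (W x / Z)%:E))%E =
      (fine (\int[P0]_x (f x * W x)%:E)%E / Z)%:E.
    rewrite EFinM fineK; last exact: integrable_fin_num (iW _ _ mf fK).
    rewrite -integralZr//; last exact: iW mf fK.
    by apply: eq_integral => x _; rewrite /= -!EFinM mulrA.
  have cvgq : (fine (scaled_integral f j) / fine (scaled_integral (cst 1) j))%:E
      @[j --> \oo] --> (fine (\int[P0]_x (f x * W x)%:E)%E / Z)%:E.
    apply/fine_cvgP; split; first exact: nearW.
    have cf : continuous f by case: f0.
    apply: cvgM; first exact: (scaled_integral_cvg cf fK).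
    by apply: cvgV Z_cvg; rewrite gt_eqF.
  apply: cvg_trans cvgq; apply: near_eq_cvg.
  apply: filterS mu_gt0 => j muj.
  rewrite (integral_normalized_mu (a_gt0 j) mf fK muj) EFinM fineK//.
  exact: integrable_fin_num (integrable_cell P _ _ mf fK).
split; first by exists Q.
move=> Q' confQ' A mA; rewrite -QE//.
apply: C0_integral_unique => // f f0.
exact: (cvg_unique (@ereal_hausdorff R) (confQ' f f0) (conf f f0)).
Qed.

End conflation_limit.

Lemma conflation_is_sub (R : realType) (n : nat) (P : 'I_n -> borel_prob R)
    (D E : borel_prob R -> Prop) :
  (forall Q, D Q -> E Q) -> conflation_is P D -> conflation_is P E.
Proof. by move=> DE [ex all]; split => // Q /all /DE. Qed.

(** * Distributions on the natural numbers *)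

Section discrete.
Context {R : realType}.
Implicit Types (Q : borel_prob R) (p q : nat -> R).

(** The natural numbers, as a set of reals. *)
Definition nats : set (measurableTypeR R) := range (fun k : nat => k%:R : R).

Lemma natsE : nats = \bigcup_k [set k%:R : R].
Proof. by apply/seteqP; split => x [k _] /= kx; exists k. Qed.

Lemma measurable_nats : measurable nats.
Proof. by rewrite natsE; apply: bigcup_measurable => k _; exact: measurable_set1. Qed.

Lemma pmf_null_setC Q p : has_pmf Q p -> Q (~` nats) = 0%E.
Proof.
move=> [_ Q1]; rewrite probability_setC; last exact: measurable_nats.
by rewrite /nats Q1 subee.
Qed.

Lemma pmf_series Q p : has_pmf Q p -> series p k @[k --> \oo] --> (1 : R).
Proof.
move=> [Qp Q1].
have : (\sum_(0 <= k < j) (p k)%:E)%E @[j --> \oo] --> 1%E.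
  under eq_fun do under eq_bigr do rewrite -Qp.
  rewrite -Q1 -/nats natsE; apply: measure_semi_sigma_additive.
  - by move=> k; exact: measurable_set1.
  - by move=> i j _ _ [x [/= -> /eqP]]; rewrite eqr_nat => /eqP.
  - by rewrite -natsE; exact: measurable_nats.
under eq_fun do rewrite sumEFin.
by move/fine_cvgP => [_].
Qed.

(** A mass function known up to a constant factor is determined by the sum of
    its shape. *)
Lemma pmf_propto_normalized Q p s :
  has_pmf_propto Q p -> series p k @[k --> \oo] --> (s : R) ->
  s != 0 /\ has_pmf Q (fun k => p k / s).
Proof.
move=> [c c0 Qp] ps.
have cs : c * s = 1.
  have h : series (fun k => c * p k) k @[k --> \oo] --> c * s.
    under eq_fun do rewrite /series /= -mulr_sumr.
    exact: cvgM (cvg_cst _) ps.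
  exact: (cvg_unique (@Rhausdorff R) h (pmf_series Qp)).
have s0 : s != 0.
  by apply: contra_eq_neq cs => ->; rewrite mulr0 eq_sym oner_neq0.
split=> //; rewrite (_ : (fun k => p k / s) = fun k => c * p k)//.
by apply/funext => k; rewrite -[c](mulfK s0) cs mul1r mulrC.
Qed.

Lemma finite_series_cvg p m : (forall k, (m <= k)%N -> p k = 0) ->
  series p k @[k --> \oo] --> \sum_(0 <= k < m) p k.
Proof.
move=> p0; apply: cvg_near_cst; near=> k.
have mk : (m <= k)%N by near: k; exact: nbhs_infty_ge.
rewrite /series /= (big_cat_nat (n := m))//= [X in _ + X]big1_seq ?addr0//.
by move=> i /=; rewrite mem_index_iota => /andP[mi _]; exact: p0.
Unshelve. all: by end_near. Qed.

Lemma cell_index_nat j m k :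
  cell_index j (k%:R : R) = cell_index j (m%:R : R) -> k = m.
Proof.
rewrite /cell_index -!natrX -!natrM => h.
have natceil (l : nat) : Num.ceil (l%:R : R) = l :> int.
  by rewrite pmulrn intrKceil.
move: h; rewrite !natceil => -[] /eqP.
by rewrite eqn_pmul2r ?expn_gt0// => /eqP.
Qed.

(** A dyadic cell contains at most one natural number, as cells have length at
    most one. *)
Lemma pmf_dyadic_cell Q p j m : has_pmf Q p ->
  Q (dyadic_cell j (cell_index j (m%:R : R))) = (p m)%:E.
Proof.
move=> Qp; have [Qpm _] := Qp; rewrite -Qpm; set B := dyadic_cell _ _.
have mB : measurable B by exact: measurable_dyadic_cell.
have BD : Q (B `\` nats) = 0%E.
  apply: (subset_measure0 _ _ (@subIsetr _ B (~` nats))).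
  - by apply: measurableD => //; exact: measurable_nats.
  - by apply: measurableC; exact: measurable_nats.
  - exact: pmf_null_setC Qp.
rewrite (measureDI Q mB measurable_nats) [X in (X + _)%E]BD add0e.
congr (Q _); apply/seteqP; split => x /=.
  by move=> [/dyadic_cellP xm [k _ kx]]; move: xm; rewrite -kx => /cell_index_nat ->.
by move=> ->; split; [exact/dyadic_cellP|exists m].
Qed.

(** The weights do not depend on the level on the natural numbers, which carry
    all of the mass of the first measure. *)
Lemma conflation_pmf (n : nat) (P : 'I_n.+1 -> borel_prob R)
    (p : 'I_n.+1 -> nat -> R) :
  compatible P -> (forall i, has_pmf (P i) (p i)) ->
  conflation_is P (fun Q => has_pmf_propto Q (fun k => \prod_i p i k)).
Proof.
move=> cP Pp.
have wE j m : cell_weight P j m%:R = \prod_(i < n) p (lift ord0 i) m.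
  by apply: eq_bigr => i _; rewrite (pmf_dyadic_cell _ _ (Pp _)).
(* Level 1 is the first one at which compatibility gives a positive mass. *)
pose W := cell_weight P 1.
have W0 x : 0 <= W x := cell_weight_ge0 P 1 x.
have mW : measurable_fun [set: measurableTypeR R] W := measurable_cell_weight P 1.
have Z0 : (0 < \int[P ord0]_x (W x)%:E)%E.
  by have := cP 1 isT; rewrite mu_integral.
apply: (@conflation_is_sub _ _ _ _ _ _ (@conflation_weighted _ _ P (fun=> 1) W 1
  _ _ _ mW W0 (cell_weight_le1 P 1) Z0)).
- move=> Q QE; set Z := fine _ in QE.
  have Zfin : (\int[P ord0]_x (W x)%:E)%E \is a fin_num.
    apply: integrable_fin_num => //.
    apply: (@integrable_bounded _ _ _ (P ord0) _ W 1) => // x.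
    by rewrite ger0_norm// cell_weight_le1.
  exists Z^-1; first by rewrite invr_gt0 fine_gt0// Z0 ltey_eq Zfin.
  split.
    move=> k; have mk : measurable ([set k%:R] : set (measurableTypeR R)).
      exact: measurable_set1.
    rewrite QE//.
    rewrite (eq_integral (cst ((\prod_(i < n) p (lift ord0 i) k) / Z)%:E)); last first.
      by move=> x /set_mem ->; rewrite /W wE.
    rewrite integral_cst//=.
    have [Ppk _] := Pp ord0; rewrite Ppk -EFinM.
    congr (_%:E).
    by rewrite big_ord_recl [RHS]mulrCA [RHS]mulrC [X in X * _ = _]mulrC.
  have mCn : measurable (~` nats) by apply: measurableC; exact: measurable_nats.
  have mg : measurable_fun [set: measurableTypeR R] (fun x => W x / Z).
    exact: measurable_funM.
  have QC : Q (~` nats) = 0%E.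
    rewrite QE// null_set_integral//; last exact: pmf_null_setC (Pp ord0).
    by apply/measurable_EFinP/measurable_funTS; exact: mg.
  by rewrite -[range _]/nats -[nats]setCK probability_setC// QC sube0.
- by [].
- by move=> j x; rewrite mul1r cell_weight_le1.
- exists (~` nats); split; [|exact: pmf_null_setC (Pp ord0)|].
    by apply: measurableC; exact: measurable_nats.
  apply: subsetC => x [k _ <-].
  apply: cvg_near_cst; apply: nearW => j.
  by rewrite mul1r /W !wE.
Qed.

Lemma conflation_pmf_propto (n : nat) (P : 'I_n.+1 -> borel_prob R)
    (p : 'I_n.+1 -> nat -> R) :
  compatible P -> (forall i, has_pmf_propto (P i) (p i)) ->
  conflation_is P (fun Q => has_pmf_propto Q (fun k => \prod_i p i k)).
Proof.
move=> cP Pp.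
have /choice[c cp] : forall i, exists c : R,
    0 < c /\ has_pmf (P i) (fun k => c * p i k).
  by move=> i; have [c c0 cp] := Pp i; exists c.
apply: (conflation_is_sub _ (conflation_pmf cP (fun i => (cp i).2))) => Q.
move=> [d d0 Qd]; exists (d * \prod_i c i).
  by rewrite mulr_gt0// prodr_gt0// => i _; have [] := cp i.
by under eq_fun do rewrite -mulrA -big_split.
Qed.

End discrete.

Lemma prodr_if (R : comPzRingType) (n : nat) (b : 'I_n.+1 -> bool)
    (F : 'I_n.+1 -> R) :
  \prod_i (if b i then F i else 0) =
  if [forall i, b i] then \prod_i F i else 0.
Proof.
case: ifPn => [/forallP ball|]; first by apply: eq_bigr => i _; rewrite ball.
rewrite negb_forall => /existsP[i bi].
by rewrite (bigD1 i)//= (negbTE bi) mul0r.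
Qed.

Lemma leq_minn_fam (n : nat) (m : 'I_n.+1 -> nat) (k : nat) :
  (k <= minn_fam m)%N = [forall i, (k <= m i)%N].
Proof.
rewrite -leEnat /minn_fam; apply/bigmin_geP/forallP => [[_ km] i|km].
  exact: km.
by split => [|i _]; exact: km.
Qed.

Lemma minn_fam_range (n : nat) (m : 'I_n.+1 -> nat) (k : nat) :
  [forall i, (1 <= k <= m i)%N] = (1 <= k <= minn_fam m)%N.
Proof.
rewrite leq_minn_fam; apply/forallP/andP => [km|[k1 /forallP km] i].
  split; first by have /andP[] := km ord0.
  by apply/forallP => i; have /andP[] := km i.
by rewrite k1 km.
Qed.

Section discrete_families.
Context {R : realType} (n : nat) (P : 'I_n.+1 -> borel_prob R).
Hypothesis cP : compatible P.

Lemma conflation_bernoulli (p : 'I_n.+1 -> R) :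
  (forall i, is_bernoulli (p i) (P i)) ->
  conflation_is P (is_bernoulli
    ((\prod_i p i) / ((\prod_i p i) + \prod_i (1 - p i)))).
Proof.
move=> Pp; have Ppmf i := (Pp i).2.
apply: (conflation_is_sub _ (conflation_pmf cP Ppmf)) => Q.
set A := \prod_i p i; set B := \prod_i (1 - p i).
have A0 : 0 <= A by apply: prodr_ge0 => i _; have [/andP[]] := Pp i.
have B0 : 0 <= B.
  by apply: prodr_ge0 => i _; have [/andP[_]] := Pp i; rewrite subr_ge0.
rewrite (_ : (fun k => _) = fun k => if k == 1%N then A else
    if k == 0%N then B else 0); last first.
  apply/funext => -[|[|k]] //=.
  by rewrite big_ord_recl mul0r.
move=> QAB.
have [] := pmf_propto_normalized QAB (@finite_series_cvg _ _ 2 _).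
  by case=> [|[|k]].
rewrite !big_nat_recl// big_geq//= addr0 [B + A]addrC => AB Qp.
have AB0 : 0 < A + B by rewrite lt_def AB addr_ge0.
split.
  by rewrite divr_ge0 ?addr_ge0//= ler_pdivrMr// mul1r lerDl.
rewrite (_ : (fun k => _) = fun k => (if k == 1%N then A else
    if k == 0%N then B else 0) / (A + B))//.
apply/funext => -[|[|k]] //=; last by rewrite mul0r.
by rewrite -[1](divff AB) -mulrBl addrAC subrr add0r.
Qed.

Lemma conflation_geometric (p : 'I_n.+1 -> R) :
  (forall i, is_geometric (p i) (P i)) ->
  conflation_is P (is_geometric (1 - \prod_i (1 - p i))).
Proof.
move=> Pp; have Ppmf i := (Pp i).2.
apply: (conflation_is_sub _ (conflation_pmf cP Ppmf)) => Q.
set q := \prod_i (1 - p i).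
have p01 i : 0 <= 1 - p i <= 1.
  by have [/andP[p0 p1]] := Pp i; rewrite subr_ge0 p1 gerBl.
have q01 : 0 <= q <= 1.
  rewrite prodr_ge0/= => [|i _]; last by have /andP[] := p01 i.
  by apply: prodr_ile1 => i _.
have /andP[q0 q1] := q01.
(* A geometric mass function with parameter 0 vanishes identically. *)
have p0_neq0 : p ord0 != 0.
  apply/eqP => p0.
  have h := @finite_series_cvg R (fun=> 0) 0 (fun _ _ => erefl).
  have := pmf_series (Ppmf ord0).
  have -> : (fun k => if (1 <= k)%N then (1 - p ord0) ^+ (k - 1) * p ord0 else 0)
      = fun=> 0.
    by apply/funext => k; rewrite p0 mulr0 if_same.
  move=> /(cvg_unique (@Rhausdorff R) h) /eqP.
  by rewrite big_geq// eq_sym oner_eq0.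
have q_lt1 : q < 1.
  rewrite /q big_ord_recl; apply: (@le_lt_trans _ _ (1 - p ord0)).
    rewrite ler_piMr//; first by have /andP[] := p01 ord0.
    by apply: prodr_ile1 => i _.
  by have [/andP[p0 _] _] := Pp ord0; rewrite ltrBlDr ltrDl lt_def p0_neq0.
set B := \prod_i p i.
have -> : (fun k => \prod_i (if (1 <= k)%N then (1 - p i) ^+ (k - 1) * p i
    else 0)) = fun k => if (1 <= k)%N then B * q ^+ (k - 1) else 0.
  apply/funext => -[|k] /=; first by rewrite big_ord_recl mul0r.
  by rewrite big_split/= prodrXl mulrC.
move=> QB.
split; first by rewrite subr_ge0 q1 gerBl.
have qnorm : `|q| < 1 by rewrite ger0_norm.
have [] := pmf_propto_normalized QB (s := B / (1 - q)) _.
  rewrite -cvg_shiftS.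
  rewrite (_ : [sequence _]_k = series (geometric B q)); last first.
    apply/funext => k; rewrite /series /= big_nat_recl//= add0r.
    by apply: eq_bigr => i _; rewrite subn1.
  exact: cvg_geometric_series.
move=> Bq Qp.
have B0 : B != 0 by apply: contraNneq Bq => ->; rewrite mul0r.
have q1' : 1 - q != 0 by rewrite subr_eq0 eq_sym lt_eqF.
rewrite (_ : (fun k => _) = fun k =>
  (if (1 <= k)%N then B * q ^+ (k - 1) else 0) / (B / (1 - q)))//.
apply/funext => k; case: ifP => _; last by rewrite mul0r.
rewrite (_ : 1 - (1 - q) = q); last by ring.
by field; rewrite q1' B0.
Qed.

Lemma conflation_discrete_uniform (m : 'I_n.+1 -> nat) :
  (forall i, is_discrete_uniform (m i) (P i)) ->
  conflation_is P (is_discrete_uniform (minn_fam m)).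
Proof.
move=> Pm; have Ppmf i := (Pm i).2.
apply: (conflation_is_sub _ (conflation_pmf cP Ppmf)) => Q.
set M := minn_fam m; set c : R := \prod_i (m i)%:R^-1.
have M1 : (1 <= M)%N by rewrite leq_minn_fam; apply/forallP => i; case: (Pm i).
have c0 : c != 0.
  by apply/prodf_neq0 => i _; rewrite invr_eq0 pnatr_eq0 -lt0n; case: (Pm i).
under eq_fun do rewrite prodr_if minn_fam_range -/M -/c.
move=> Qc; split => //.
have [] := pmf_propto_normalized Qc (@finite_series_cvg _ _ M.+1 _).
  by move=> k Mk; rewrite [(k <= M)%N]leqNgt Mk andbF.
have -> : \sum_(0 <= k < M.+1) (if (1 <= k <= M)%N then c else 0) = M%:R * c.
  rewrite big_nat_recl//= add0r (eq_big_nat _ _ (F2 := fun=> c)).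
    by rewrite sumr_const_nat subn0 mulr_natl.
  by move=> i /andP[_ iM]; rewrite iM.
move=> _ Qp; rewrite (_ : (fun k => _) = fun k =>
    (if (1 <= k <= M)%N then c else 0) / (M%:R * c))//.
apply/funext => k; case: ifP => _; last by rewrite mul0r.
by rewrite invfM mulrCA divff// mulr1.
Qed.

Lemma powR_prod (r : 'I_n.+1 -> R) (x : R) : 0 < x ->
  \prod_i x `^ (r i) = x `^ (\sum_i r i).
Proof.
move=> x0; apply: (big_rec2 (fun a b => a = x `^ b)); first by rewrite powRr0.
by move=> i a b _ ->; rewrite powRD// (gt_eqF x0)/= implybT.
Qed.

Lemma conflation_zipf (alpha : 'I_n.+1 -> R) (m : 'I_n.+1 -> nat) :
  (forall i, is_zipf (alpha i) (m i) (P i)) ->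
  conflation_is P (is_zipf (\sum_i alpha i) (minn_fam m)).
Proof.
move=> Pz.
have Pp i : has_pmf_propto (P i)
    (fun k => if (1 <= k <= m i)%N then k%:R `^ (- alpha i) else 0).
  by case: (Pz i).
apply: (conflation_is_sub _ (conflation_pmf_propto cP Pp)) => Q.
rewrite (_ : (fun k => _) = fun k => if (1 <= k <= minn_fam m)%N then
    k%:R `^ (- \sum_i alpha i) else 0); last first.
  apply/funext => k; rewrite prodr_if minn_fam_range; case: ifPn => // /andP[k0 _].
  by rewrite powR_prod ?ltr0n// sumrN.
split => //.
- rewrite big_ord_recl ltr_pwDl//; first by case: (Pz ord0).
  by apply: sumr_ge0 => i _; case: (Pz (lift ord0 i)) => /ltW.
- by rewrite leq_minn_fam; apply/forallP => i; case: (Pz i).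
Qed.

Lemma conflation_zeta (alpha : 'I_n.+1 -> R) :
  (forall i, is_zeta (alpha i) (P i)) ->
  conflation_is P (is_zeta (\sum_i alpha i)).
Proof.
move=> Pz; have Pp i := (Pz i).2.
apply: (conflation_is_sub _ (conflation_pmf_propto cP Pp)) => Q.
rewrite (_ : (fun k => _) = fun k => if (1 <= k)%N then
    k%:R `^ (- \sum_i alpha i) else 0); last first.
  apply/funext => -[|k] /=; first by rewrite big_ord_recl mul0r.
  by rewrite powR_prod ?ltr0n// sumrN.
split => //; rewrite big_ord_recl ltr_wpDr//; last by case: (Pz ord0).
apply: sumr_ge0 => i _; apply: ltW; apply: lt_trans ltr01 _.
by case: (Pz (lift ord0 i)).
Qed.

End discrete_families.

(** * Distributions with a density *)

Section continuous.
Context {R : realType}.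
Local Notation lambda := (@lebesgue_measure R).

Lemma dyadicB j k : dyadic R j k - dyadic R j (k - 1) = 2 ^- j.
Proof. by rewrite /dyadic -mulrBl intrB opprB addrCA subrr addr0 mul1r. Qed.

Lemma lebesgue_dyadic_cell j k :
  lambda (dyadic_cell j k) = (2 ^- j)%:E.
Proof.
rewrite /dyadic_cell lebesgue_measure_itv/= lte_fin.
have h : dyadic R j (k - 1) < dyadic R j k.
  by rewrite -subr_gt0 dyadicB invr_gt0 exprn_gt0.
by rewrite h -EFinB dyadicB.
Qed.

Lemma dyadic_cell_nicely_shrinking (x : R) :
  nicely_shrinking x (fun j => dyadic_cell j (cell_index j x)).
Proof.
have pow0 j : (0 : R) < 2 ^- j by rewrite invr_gt0 exprn_gt0.
split; first by move=> j; exact: measurable_dyadic_cell.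
(* The ball of radius [2 ^- j] around [x] contains the cell and is twice as
   long. *)
exists (2, fun j => PosNum (pow0 j)); split => //=.
- exact: cvg_inv_expr2.
- move=> j y; set k := cell_index j x => yk.
  have : dyadic_cell j k x by apply/dyadic_cellP.
  move: yk; rewrite /dyadic_cell /= !in_itv/= => /andP[y1 y2] /andP[x1 x2].
  have := dyadicB j k; rewrite /ball/= ltr_norml; lra.
- move=> j; rewrite lebesgue_measure_ball; last exact: ltW.
  by rewrite lebesgue_dyadic_cell -EFinM lee_fin mulr_natl.
Qed.

Section one_density.
Context (Q : borel_prob R) (f : R -> R) (fQ : has_density Q f).

Lemma has_density_dominates : Q `<< lambda.
Proof. by case: fQ => mf _ QE; exact: (density_dominates mf QE). Qed.

Lemma has_density_locally_integrable : locally_integrable [set: R] f.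
Proof.
have [mf f0 QE] := fQ; split => //; first exact: openT.
move=> K _ cK; have mK : measurable (K : set (measurableTypeR R)).
  exact: compact_measurable.
under eq_integral do rewrite ger0_norm//.
by rewrite -QE// (le_lt_trans (probability_le1 _ _)) ?ltry.
Qed.

(** By Lebesgue differentiation the average density over the dyadic cells
    around [x] converges to the density at almost every [x], whether or not the
    density is continuous. *)
Lemma has_density_cell_cvg :
  {ae lambda, forall x,
    2 ^+ j * fine (Q (dyadic_cell j (cell_index j x))) @[j --> \oo] -->
    (f x : R)}.
Proof.
have [mf f0 QE] := fQ.
have := lebesgue_differentiation has_density_locally_integrable.
apply: filterS; first exact: (ae_filter_ringOfSetsType lambda).
move=> x fx.
have := nice_lebesgue_differentiation dyadic_cell_nicely_shrinking
  has_density_locally_integrable fx.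
rewrite (_ : (fun j => _) = fun j =>
    (2 ^+ j * fine (Q (dyadic_cell j (cell_index j x))))%:E).
  by move/fine_cvgP => [].
apply/funext => j; rewrite lebesgue_dyadic_cell inver gt_eqF ?invr_gt0 ?exprn_gt0//.
have mc : measurable (@dyadic_cell R j (cell_index j x)).
  exact: measurable_dyadic_cell.
by rewrite -QE// EFinM invrK fineK// fin_num_measure.
Qed.

Lemma has_density_cell_le (M : R) j k : (forall x, f x <= M) ->
  2 ^+ j * fine (Q (dyadic_cell j k)) <= M.
Proof.
have [mf f0 QE] := fQ => fM.
have mc : measurable (@dyadic_cell R j k) := measurable_dyadic_cell j k.
rewrite mulrC -ler_pdivlMr ?exprn_gt0// -lee_fin fineK ?fin_num_measure//.
rewrite QE//; apply: (@le_trans _ _ (\int[lambda]_(x in dyadic_cell j k) M%:E)%E).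
  apply: ge0_le_integral => //=.
  - by move=> x _; rewrite lee_fin.
  - by apply/measurable_EFinP/measurable_funTS.
  - by move=> x _; rewrite lee_fin.
by rewrite integral_cst//= [X in (_ * X)%E]lebesgue_dyadic_cell EFinM.
Qed.

End one_density.

Lemma integral_gt0 (F : R -> R) (u v : R) :
  measurable_fun [set: measurableTypeR R] F -> (forall x, 0 <= F x) ->
  u < v -> (forall x, u < x < v -> 0 < F x) ->
  (0 < \int[lambda]_x (F x)%:E)%E.
Proof.
move=> mF F0 uv Fpos.
have iF0 : (0 <= \int[lambda]_x (F x)%:E)%E.
  by apply: integral_ge0 => x _; rewrite lee_fin.
rewrite lt_def iF0 andbT; apply/eqP => iF.
have mFE : measurable_fun [set: measurableTypeR R] (EFin \o F).
  exact/measurable_EFinP.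
have : ae_eq lambda setT (EFin \o F) (cst 0%E).
  apply/(ae_eq_integral_abs lambda measurableT mFE).
  by under eq_integral do rewrite /= ger0_norm//.
move=> [N [mN N0 subN]].
have : lambda (`]u, v[%classic : set R) = 0%E.
  apply: (subset_measure0 _ mN _ N0); first exact: measurable_itv.
  move=> x; rewrite /= in_itv/= => /Fpos Fx; apply: subN => /= /(_ I) [].
  by move=> /eqP; rewrite gt_eqF.
rewrite lebesgue_measure_itv/= lte_fin uv -EFinB => -[] /eqP.
by rewrite subr_eq0 gt_eqF.
Qed.

(** Conflating measures with bounded densities multiplies the densities. *)
Lemma conflation_density (n : nat) (P : 'I_n.+1 -> borel_prob R)
    (f : 'I_n.+1 -> R -> R) :
  (forall i, has_density (P i) (f i)) ->
  (forall i, exists M, forall x, f i x <= M) ->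
  (0 < \int[lambda]_x (\prod_i f i x)%:E)%E ->
  conflation_is P (fun Q => has_density_propto Q (fun x => \prod_i f i x)).
Proof.
move=> fP /choice[M fM] F0.
pose W x := \prod_(i < n) f (lift ord0 i) x.
pose C := \prod_(i < n) M (lift ord0 i).
have f0 i x : 0 <= f i x by case: (fP i).
have mf i : measurable_fun [set: measurableTypeR R] (f i) by case: (fP i).
have mW : measurable_fun [set: measurableTypeR R] W.
  by apply: measurable_prod => i _; exact: mf.
have W0 x : 0 <= W x by apply: prodr_ge0 => i _.
have WC x : W x <= C by apply: ler_prod => i _; rewrite f0 fM.
have [mf0 _ P0E] := fP ord0.
have WfE x : W x * f ord0 x = \prod_i f i x by rewrite big_ord_recl mulrC.
have iWA (g : R -> R) A : measurable A -> (P ord0).-integrable A (EFin \o g) ->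
    (\int[P ord0]_(x in A) (g x)%:E =
     \int[lambda]_(x in A) (g x * f ord0 x)%:E)%E.
  move=> mA gi; rewrite (integral_density mf0 P0E mA gi).
  by apply: eq_integral => x _; rewrite EFinM.
have iW : (P ord0).-integrable [set: measurableTypeR R] (EFin \o W).
  apply: (@integrable_bounded _ _ _ (P ord0) _ W C) => // x.
  by rewrite ger0_norm.
have Z0 : (0 < \int[P ord0]_x (W x)%:E)%E.
  by rewrite iWA//; under eq_integral do rewrite WfE.
have awE j x : (2 ^+ j) ^+ n * cell_weight P j x = \prod_(i < n)
    (2 ^+ j * fine (P (lift ord0 i) (dyadic_cell j (cell_index j x)))) :> R.
  by rewrite big_split/= prodr_const card_ord.
apply: (conflation_is_sub _ (@conflation_weighted _ _ P
  (fun j => (2 ^+ j) ^+ n) W C _ _ _ mW W0 WC Z0)).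
- move=> Q; set Z := fine _ => QE.
  have Zgt0 : 0 < Z by rewrite fine_gt0// Z0 ltey_eq (integrable_fin_num _ iW).
  exists Z^-1; first by rewrite invr_gt0.
  split.
  - by apply: measurable_funM => //; apply: measurable_prod => i _; exact: mf.
  - by move=> x; rewrite mulr_ge0 ?invr_ge0 ?(ltW Zgt0)// prodr_ge0.
  - move=> A mA; rewrite QE// iWA//; last first.
      apply: (@integrable_bounded _ _ _ (P ord0) _ (fun x => W x / Z) (C / Z)) => //.
        exact: measurable_funM.
      move=> x; rewrite ger0_norm ?divr_ge0 ?(ltW Zgt0)//.
      by rewrite ler_pM2r ?invr_gt0.
    by apply: eq_integral => x _; rewrite -WfE mulrAC mulrC.
- by move=> j; rewrite !exprn_gt0.
- move=> j x; rewrite awE; apply: ler_prod => i _.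
  by rewrite mulr_ge0 ?exprn_ge0 ?fine_ge0//= (has_density_cell_le (fP _)).
- have : {ae lambda, forall x, forall i : 'I_n, 2 ^+ j *
      fine (P (lift ord0 i) (dyadic_cell j (cell_index j x))) @[j --> \oo] -->
      (f (lift ord0 i) x : R)}.
    apply: filter_forall.
    by move=> i; exact: has_density_cell_cvg.
  move=> [N [mN N0 subN]]; exists N; split => //.
    exact: (null_content_dominatesP _ _).1 (has_density_dominates (fP ord0)) _ mN N0.
  apply: subset_trans subN; apply: subsetC => x /= h.
  rewrite (_ : (fun j => _) = fun j => \prod_(i < n) (2 ^+ j *
    fine (P (lift ord0 i) (dyadic_cell j (cell_index j x))))); last first.
    by apply/funext => j; rewrite awE.
  by apply: (cvg_big (@mul_continuous R)) => i _; exact: h.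
Qed.

End continuous.

Lemma lt_min_fam (R : realType) (n : nat) (b : 'I_n.+1 -> R) (x : R) :
  (x < min_fam b) = [forall i, x < b i].
Proof.
apply/bigmin_gtP/forallP => [[_ xb] i|xb]; first exact: xb.
by split => [|i _]; exact: xb.
Qed.

Lemma max_fam_lt (R : realType) (n : nat) (a : 'I_n.+1 -> R) (x : R) :
  (max_fam a < x) = [forall i, a i < x].
Proof.
apply/bigmax_ltP/forallP => [[_ ax] i|ax]; first exact: ax.
by split => [|i _]; exact: ax.
Qed.

Section continuous_families.
Context {R : realType} (n : nat) (P : 'I_n.+1 -> borel_prob R).
Local Notation lambda := (@lebesgue_measure R).

(** The interval ]u, v[ only serves to make the product of the shapes have a
    positive integral. *)
Lemma conflation_density_propto (g : 'I_n.+1 -> R -> R) (u v : R) :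
  (forall i, has_density_propto (P i) (g i)) ->
  (forall i, exists M, forall x, g i x <= M) ->
  u < v -> (forall i x, u < x < v -> 0 < g i x) ->
  conflation_is P (fun Q => has_density_propto Q (fun x => \prod_i g i x)).
Proof.
move=> gP gM uv g0.
have /choice[c cg] : forall i, exists c : R,
    0 < c /\ has_density (P i) (fun x => c * g i x).
  by move=> i; have [c c0 cg] := gP i; exists c.
have fP i := (cg i).2.
have cprod x : \prod_i (c i * g i x) = (\prod_i c i) * \prod_i g i x.
  exact: big_split.
apply: (conflation_is_sub _ (conflation_density fP _ _)).
- move=> Q [d d0 Qd]; exists (d * \prod_i c i).
    by rewrite mulr_gt0// prodr_gt0// => i _; case: (cg i).
  by move: Qd; under eq_fun do rewrite cprod mulrA.
- move=> i; have [M gMi] := gM i; exists (c i * M) => x.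
  by rewrite ler_pM2l//; case: (cg i).
- apply: (integral_gt0 _ _ uv).
  + by apply: measurable_prod => i _; case: (fP i).
  + by move=> x; apply: prodr_ge0 => i _; case: (fP i).
  + move=> x uxv; apply: prodr_gt0 => i _; apply: mulr_gt0; last exact: g0.
    by case: (cg i).
Qed.

Lemma sumr_inv_gt0 (alpha : 'I_n.+1 -> R) : (forall i, 0 < alpha i) ->
  0 < \sum_i (alpha i)^-1.
Proof.
move=> a0; rewrite big_ord_recl ltr_pwDl ?invr_gt0// sumr_ge0// => i _.
by rewrite invr_ge0 ltW.
Qed.

Lemma expR_prod_inv (alpha : 'I_n.+1 -> R) (x : R) :
  \prod_i expR (- x / alpha i) = expR (- x / (\sum_i (alpha i)^-1)^-1).
Proof. by rewrite -expR_sum invrK mulr_sumr. Qed.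

(** Follows from [1 + y <= expR y] at [y = x / (b * k.+1)], raised to the power
    [k.+1]. *)
Lemma exprn_expR_bounded (k : nat) (b x : R) : 0 < b -> 0 <= x ->
  x ^+ k * expR (- x / b) <= (b * k.+1%:R) ^+ k.
Proof.
move=> b0 x0; rewrite mulNr expRN ler_pdivrMr ?expR_gt0//.
have m0 : 0 < b * k.+1%:R by rewrite mulr_gt0.
pose y := x / (b * k.+1%:R).
have y0 : 0 <= y by rewrite divr_ge0// ltW.
have -> : x / b = k.+1%:R * y.
  rewrite /y; move: (k.+1%:R : R) (pnatr_eq0 R k.+1) => m /= /negbT mneq0.
  by field; rewrite mneq0 gt_eqF.
have -> : x = (b * k.+1%:R) * y by rewrite /y mulrC divfK// gt_eqF.
rewrite exprMn ler_wpM2l ?exprn_ge0 ?(ltW m0)//.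
rewrite expRM_natl; apply: (@le_trans _ _ ((1 + y) ^+ k)).
  by rewrite lerXn2r ?nnegrE ?addr_ge0// lerDr.
apply: (@le_trans _ _ ((1 + y) ^+ k.+1)).
  by rewrite exprS ler_peMl ?exprn_ge0 ?addr_ge0// lerDl.
by rewrite lerXn2r ?nnegrE ?addr_ge0 ?expR_ge0// expR_ge1Dx.
Qed.

Lemma conflation_gamma (alpha : 'I_n.+1 -> nat) (beta : 'I_n.+1 -> R) :
  (forall i, is_gamma (alpha i) (beta i) (P i)) ->
  conflation_is P (is_gamma ((\sum_i alpha i) - n)%N
    (\sum_i (beta i)^-1)^-1).
Proof.
move=> Pg.
have a1 i : (1 <= alpha i)%N by case: (Pg i).
have b0 i : 0 < beta i by case: (Pg i).
have Pd i : has_density_propto (P i) (fun x =>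
    if 0 < x then x ^+ (alpha i - 1) * expR (- x / beta i) else 0).
  by case: (Pg i).
have sumE : (\sum_i alpha i = \sum_i (alpha i - 1) + n.+1)%N.
  rewrite -[X in (_ + X)%N]card_ord -sum1_card -big_split/=.
  by apply: eq_bigr => i _; rewrite subnK.
apply: (conflation_is_sub _ (conflation_density_propto Pd _ ltr01 _)).
- move=> Q; set g := (X in has_density_propto Q X) => Qg.
  split.
  + by rewrite sumE addnS -addSn addnK.
  + by rewrite invr_gt0 sumr_inv_gt0.
  + rewrite (_ : (fun x => _) = g)//; apply/funext => x; rewrite /g.
    case: ifPn => x0; last by rewrite big_ord_recl mul0r.
    rewrite big_split/= prodrXr expR_prod_inv; congr (_ ^+ _ * _).
    by rewrite sumE addnS -addSn addnK subn1.
- move=> i; exists ((beta i * (alpha i - 1).+1%:R) ^+ (alpha i - 1)) => x.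
  case: ifPn => x0; first by rewrite exprn_expR_bounded// ltW.
  by rewrite exprn_ge0// mulr_ge0// ltW.
- move=> i x /andP[x0 _]; rewrite x0 mulr_gt0 ?expR_gt0//.
  by rewrite exprn_gt0.
Qed.

Lemma conflation_exponential (alpha : 'I_n.+1 -> R) :
  (forall i, is_exponential (alpha i) (P i)) ->
  conflation_is P (is_exponential (\sum_i (alpha i)^-1)^-1).
Proof.
move=> Pe; have a0 i := (Pe i).1; have Pd i := (Pe i).2.
apply: (conflation_is_sub _ (conflation_density_propto Pd _ ltr01 _)).
- move=> Q; set g := (X in has_density_propto Q X) => Qg.
  split; first by rewrite invr_gt0 sumr_inv_gt0.
  rewrite (_ : (fun x => _) = g)//; apply/funext => x; rewrite /g.
  case: ifPn => x0; last by rewrite big_ord_recl mul0r.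
  by rewrite expR_prod_inv.
- move=> i; exists 1 => x; case: ifPn => // x0.
  by rewrite expR_le1 mulNr oppr_le0 divr_ge0// ltW.
- by move=> i x /andP[-> _]; exact: expR_gt0.
Qed.

Lemma conflation_laplace (alpha : 'I_n.+1 -> R) :
  (forall i, is_laplace (alpha i) (P i)) ->
  conflation_is P (is_laplace (\sum_i (alpha i)^-1)^-1).
Proof.
move=> Pe; have a0 i := (Pe i).1; have Pd i := (Pe i).2.
apply: (conflation_is_sub _ (conflation_density_propto Pd _ ltr01 _)).
- move=> Q; set g := (X in has_density_propto Q X) => Qg.
  split; first by rewrite invr_gt0 sumr_inv_gt0.
  rewrite (_ : (fun x => _) = g)//; apply/funext => x; rewrite /g.
  by rewrite expR_prod_inv.
- move=> i; exists 1 => x.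
  by rewrite expR_le1 mulNr oppr_le0 divr_ge0// ltW.
- by move=> i x _; exact: expR_gt0.
Qed.

Lemma conflation_beta (alpha beta : 'I_n.+1 -> R) :
  (forall i, is_beta (alpha i) (beta i) (P i)) ->
  conflation_is P (is_beta ((\sum_i alpha i) - n%:R)
    ((\sum_i beta i) - n%:R)).
Proof.
move=> Pb.
have a1 i : 1 < alpha i by case: (Pb i).
have b1 i : 1 < beta i by case: (Pb i).
have Pd i : has_density_propto (P i) (fun x => if 0 < x < 1 then
    x `^ (alpha i - 1) * (1 - x) `^ (beta i - 1) else 0).
  by case: (Pb i).
have sumE (s : 'I_n.+1 -> R) : \sum_i (s i - 1) = \sum_i s i - n%:R - 1.
  by rewrite big_split/= sumr_const card_ord mulNrn -natr1 opprD addrA.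
have sum_gt1 (s : 'I_n.+1 -> R) : (forall i, 1 < s i) ->
    1 < \sum_i s i - n%:R.
  move=> s1; rewrite -subr_gt0 -sumE big_ord_recl ltr_pwDl ?subr_gt0//.
  by apply: sumr_ge0 => i _; rewrite subr_ge0 ltW.
have powR_unit_le1 (x r : R) : 0 < x < 1 -> 1 < r -> x `^ (r - 1) <= 1.
  move=> /andP[x0 x1] r1; rewrite [leRHS](_ : 1 = 1 `^ (r - 1)); last by rewrite powR1.
  rewrite ge0_ler_powR ?nnegrE//.
  - by rewrite subr_ge0 ltW.
  - exact: ltW.
  - exact: ltW.
apply: (conflation_is_sub _ (conflation_density_propto Pd _ ltr01 _)).
- move=> Q; set g := (X in has_density_propto Q X) => Qg.
  split; [exact: sum_gt1|exact: sum_gt1|].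
  rewrite (_ : (fun x => _) = g)//; apply/funext => x; rewrite /g.
  case: ifPn => [/andP[x0 x1]|_]; last by rewrite big_ord_recl mul0r.
  by rewrite big_split/= !powR_prod ?subr_gt0// !sumE.
- move=> i; exists 1 => x; case: ifPn => // x01.
  apply: mulr_ile1; rewrite ?powR_ge0 ?powR_unit_le1//.
  by move: x01 => /andP[x0 x1]; rewrite subr_gt0 x1 gtrBl.
- move=> i x /[dup] /andP[x0 x1] ->.
  by rewrite mulr_gt0// powR_gt0// subr_gt0.
Qed.

Lemma conflation_pareto (alpha beta : 'I_n.+1 -> R) :
  (forall i, is_pareto (alpha i) (beta i) (P i)) ->
  conflation_is P (is_pareto ((\sum_i alpha i) + n%:R) (max_fam beta)).
Proof.
move=> Pp.
have a0 i : 0 < alpha i by case: (Pp i).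
have b0 i : 0 < beta i by case: (Pp i).
have Pd i : has_density_propto (P i) (fun x => if beta i < x then
    x `^ (- (alpha i + 1)) else 0).
  by case: (Pp i).
have maxb i x : max_fam beta < x -> beta i < x.
  by rewrite max_fam_lt => /forallP.
have maxb0 : 0 < max_fam beta.
  rewrite ltNge; apply/negP => mb0.
  have := maxb ord0 (beta ord0) (le_lt_trans mb0 (b0 _)).
  by rewrite ltxx.
have bb1 : max_fam beta < max_fam beta + 1 by rewrite ltrDl.
apply: (conflation_is_sub _ (conflation_density_propto Pd _ bb1 _)).
- move=> Q; set g := (X in has_density_propto Q X) => Qg.
  split => //.
    rewrite big_ord_recl -addrA ltr_pwDl// addr_ge0//.
    by apply: sumr_ge0 => i _; rewrite ltW.
  rewrite (_ : (fun x => _) = g)//; apply/funext => x.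
  rewrite /g prodr_if -max_fam_lt; case: ifPn => // bx.
  rewrite powR_prod ?(lt_trans maxb0)// sumrN big_split/= sumr_const card_ord.
  by rewrite -natr1 addrA.
- move=> i; exists (beta i `^ (- (alpha i + 1))) => x.
  case: ifPn => bx; last exact: powR_ge0.
  have x0 : 0 < x := lt_trans (b0 i) bx.
  rewrite !powRN lef_pV2 ?posrE ?powR_gt0//.
  have a1 : 0 <= alpha i + 1 by rewrite addr_ge0// ltW.
  by rewrite (ge0_ler_powR a1) ?nnegrE//; exact: ltW.
- move=> i x /andP[bx _]; rewrite (maxb i x bx) powR_gt0//.
  exact: lt_trans maxb0 bx.
Qed.

(** The constant value of a uniform density is forced by the total mass. *)
Lemma uniform_density_value (Q : borel_prob R) (a b K : R) : a < b ->
  has_density Q (fun x => if a < x < b then K else 0) -> K = (b - a)^-1.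
Proof.
move=> ab [_ _ QE].
have : Q setT = (K * (b - a))%:E.
  rewrite QE//; transitivity (\int[lambda]_(x in `]a, b[) K%:E)%E.
    rewrite [RHS]integral_mkcond; apply: eq_integral => x _.
    by rewrite patchE mem_setE in_itv/=; case: ifP.
  rewrite integral_cst/=; last exact: measurable_itv.
  by rewrite lebesgue_measure_itv/= lte_fin ab -EFinB -EFinM.
rewrite probability_setT => -[] K1.
have ba : b - a != 0 by rewrite subr_eq0 gt_eqF.
by rewrite -[LHS](mulfK ba) -K1 mul1r.
Qed.

(** If [b i < a l], a dyadic cell finer than the gap cannot meet both
    intervals, so that the discretized product vanishes. *)
Lemma compatible_uniform_le (a b : 'I_n.+1 -> R) : compatible P ->
  (forall i, is_uniform (a i) (b i) (P i)) -> forall l i, a l <= b i.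
Proof.
move=> cP Pu l i; rewrite leNgt; apply/negP => ba.
have e0 : 0 < a l - b i by rewrite subr_gt0.
have [N _ hN] : \forall j \near \oo, (2 ^- j : R) < a l - b i.
  exact: (cvgr_lt _ (@cvg_inv_expr2 R)).
have := cP N.+1 isT; rewrite /mu_ esum1 ?ltxx// => k _.
have {}hN := hN N.+1 (leqnSn N).
have Pi0 m : (forall x, dyadic_cell N.+1 k x -> (a m < x < b m) = false) ->
    P m (dyadic_cell N.+1 k) = 0%E.
  move=> hm; have [_ [_ _ ->]] := Pu m; last exact: measurable_dyadic_cell.
  rewrite integral0_eq// => x kx; by rewrite hm.
have [kl|kl] := leP (dyadic R N.+1 k) (a l).
  rewrite (bigD1 l)//= Pi0 ?mul0e// => x; rewrite /dyadic_cell/= in_itv/=.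
  by move=> /andP[_ xk]; rewrite ltNge (le_trans xk kl).
rewrite (bigD1 i)//= Pi0 ?mul0e// => x; rewrite /dyadic_cell/= in_itv/=.
move=> /andP[kx _]; rewrite andbC ltNge (_ : b i <= x)//.
move: kx kl hN; have := dyadicB (R := R) N.+1 k; lra.
Qed.

Lemma conflation_uniform (a b : 'I_n.+1 -> R) : compatible P ->
  (forall i, is_uniform (a i) (b i) (P i)) ->
  max_fam a <> min_fam b ->
  conflation_is P (is_uniform (max_fam a) (min_fam b)).
Proof.
move=> cP Pu abneq.
(* Compatibility gives the weak inequality, and equality is excluded. *)
have ab : max_fam a < min_fam b.
  rewrite lt_neqAle; apply/andP; split; first exact/eqP.
  have le_ab := compatible_uniform_le cP Pu.
  apply/bigmax_leP; split => [|l _]; apply/bigmin_geP; split => *; exact: le_ab.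
have Pd i : has_density_propto (P i) (fun x =>
    if a i < x < b i then (b i - a i)^-1 else 0).
  by exists 1 => //; under eq_fun do rewrite mul1r; case: (Pu i).
have ba i : 0 < (b i - a i)^-1 by rewrite invr_gt0 subr_gt0; case: (Pu i).
have inE x : (max_fam a < x < min_fam b) = [forall i, a i < x < b i].
  rewrite max_fam_lt lt_min_fam; apply/andP/forallP => [[/forallP ax /forallP xb] i|h].
    by rewrite ax xb.
  by split; apply/forallP => i; have /andP[] := h i.
apply: (conflation_is_sub _ (conflation_density_propto Pd _ ab _)).
- move=> Q [c c0]; set g := (X in has_density Q X) => Qg; split => //.
  have gE : g = fun x => if max_fam a < x < min_fam b then
      c * \prod_i (b i - a i)^-1 else 0.
    by apply/funext => x; rewrite /g prodr_if -inE; case: ifP; rewrite ?mulr0.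
  by rewrite gE in Qg; rewrite -(uniform_density_value ab Qg).
- by move=> i; exists (b i - a i)^-1 => x; case: ifP => // _; exact: ltW.
- by move=> i x; rewrite inE => /forallP ->.
Qed.

End continuous_families.

(** * Closure properties of conflation *)

(* The number of measures is [n.+1], so the paper's "n - 1" is [n].
   In the continuous uniform case the target interval is only meaningful for
   max a < min b; compatibility excludes max a > min b but not equality. *)
Theorem theorem7p1 (R : realType) (n : nat) (P : 'I_n.+1 -> borel_prob R)
    (cP : compatible P) :
  (forall p : 'I_n.+1 -> R,
     (forall i, is_bernoulli (p i) (P i)) ->
     conflation_is P (is_bernoulli
       ((\prod_i p i) / ((\prod_i p i) + \prod_i (1 - p i))))) /\
  (forall p : 'I_n.+1 -> R,
     (forall i, is_geometric (p i) (P i)) ->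
     conflation_is P (is_geometric (1 - \prod_i (1 - p i)))) /\
  (forall m : 'I_n.+1 -> nat,
     (forall i, is_discrete_uniform (m i) (P i)) ->
     conflation_is P (is_discrete_uniform (minn_fam m))) /\
  (forall (alpha : 'I_n.+1 -> R) (m : 'I_n.+1 -> nat),
     (forall i, is_zipf (alpha i) (m i) (P i)) ->
     conflation_is P (is_zipf (\sum_i alpha i) (minn_fam m))) /\
  (forall alpha : 'I_n.+1 -> R,
     (forall i, is_zeta (alpha i) (P i)) ->
     conflation_is P (is_zeta (\sum_i alpha i))) /\
  (forall (alpha : 'I_n.+1 -> nat) (beta : 'I_n.+1 -> R),
     (forall i, is_gamma (alpha i) (beta i) (P i)) ->
     conflation_is P (is_gamma ((\sum_i alpha i) - n)%N
       (\sum_i (beta i)^-1)^-1)) /\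
  (forall alpha beta : 'I_n.+1 -> R,
     (forall i, is_beta (alpha i) (beta i) (P i)) ->
     conflation_is P (is_beta ((\sum_i alpha i) - n%:R)
       ((\sum_i beta i) - n%:R))) /\
  (forall a b : 'I_n.+1 -> R,
     (forall i, is_uniform (a i) (b i) (P i)) ->
     max_fam a <> min_fam b ->
     conflation_is P (is_uniform (max_fam a) (min_fam b))) /\
  (forall alpha : 'I_n.+1 -> R,
     (forall i, is_laplace (alpha i) (P i)) ->
     conflation_is P (is_laplace (\sum_i (alpha i)^-1)^-1)) /\
  (forall alpha beta : 'I_n.+1 -> R,
     (forall i, is_pareto (alpha i) (beta i) (P i)) ->
     conflation_is P (is_pareto ((\sum_i alpha i) + n%:R)
       (max_fam beta))) /\
  (forall alpha : 'I_n.+1 -> R,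
     (forall i, is_exponential (alpha i) (P i)) ->
     conflation_is P (is_exponential (\sum_i (alpha i)^-1)^-1)).
Proof.
split; first exact: conflation_bernoulli.
split; first exact: conflation_geometric.
split; first exact: conflation_discrete_uniform.
split; first exact: conflation_zipf.
split; first exact: conflation_zeta.
split; first exact: conflation_gamma.
split; first exact: conflation_beta.
split; first by move=> a b; exact: conflation_uniform.
split; first exact: conflation_laplace.
split; first exact: conflation_pareto.
exact: conflation_exponential.
Qed.
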